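(* Let $\xi=(\xi(x))_{x\in\mathbb{R}^d}$ be a real-valued, zero-mean, second-order random process with continuous covariance function $k(x,y)=\mathsf{E}[\xi(x)\xi(y)]$. Suppose that $\xi$ is second-order stationary and has a spectral density $S$ for which there exist $C>0$ and an integer $r\ge1$ such that $S(u)\,(1+|u|^r)\ge C$ for almost every $u\in\mathbb{R}^d$. Let $(x_n)_{n\ge1}$ be a sequence in $\mathbb{R}^d$ such that the set $\{x_n : n\ge1\}$ is bounded, and denote by $\mathbb{X}_0$ its (compact) closure in $\mathbb{R}^d$. For $x\in\mathbb{R}^d$ and $n\ge1$, let $\lambda_{n,x}$ be the finitely supported measure on $\mathbb{R}^d$ giving the kriging predictor of $\xi(x)$ from $\xi(x_1),\dots,\xi(x_n)$. Then, for all $x\in\mathbb{X}_0$, the following assertions are equivalent: (i) for every continuous function $f:\mathbb{R}^d\to\mathbb{R}$, $\lim_{n\to\infty}\langle\lambda_{n,x},f\rangle=f(x)$; (ii) the Lebesgue constant at $x$ is bounded, i.e. $\sup_{n\ge1}\|\lambda_{n,x}\|_{\mathrm{TV}}<\infty$.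
   Context: Write $\underline{x}_n=(x_1,\dots,x_n)$. For $x\in\mathbb{R}^d$, the kriging predictor of $\xi(x)$ is the orthogonal projection in $L^2(\Omega,\mathcal{A},\mathsf{P})$ of $\xi(x)$ onto $\mathrm{span}\{\xi(x_1),\dots,\xi(x_n)\}$, written $\hat\xi(x;\underline{x}_n)=\sum_{i=1}^n\lambda^i(x;\underline{x}_n)\,\xi(x_i)$. The associated finitely supported measure is $\lambda_{n,x}=\sum_{i=1}^n\lambda^i(x;\underline{x}_n)\,\delta_{x_i}$, where $\delta_y$ is the Dirac measure at $y$, and for a function $f$, $\langle\lambda_{n,x},f\rangle=\sum_{i=1}^n\lambda^i(x;\underline{x}_n)f(x_i)$. The Lebesgue constant at $x$ (for given $n$) is the total variation norm $\|\lambda_{n,x}\|_{\mathrm{TV}}$ of this measure, which equals $\sum_{i=1}^n|\lambda^i(x;\underline{x}_n)|$ (when the points $x_1,\dots,x_n$ are distinct). Spectral density: $\xi$ is second-order stationary if $k(x,y)$ depends only on $x-y$; it has spectral density $S$ if $S\ge0$ is integrable on $\mathbb{R}^d$ and $k(x,y)=(2\pi)^{-d}\int_{\mathbb{R}^d}e^{iu\cdot(x-y)}S(u)\,du$ (the normalization constant is immaterial). $|\cdot|$ denotes the Euclidean norm on $\mathbb{R}^d$. *)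

(* Defs.v *)
From HB Require Import structures.
From mathcomp Require Import all_boot all_order all_algebra.
From mathcomp Require Import complex.
From mathcomp Require Import all_classical all_reals all_analysis.
Import Order.TTheory GRing.Theory Num.Theory.
Import numFieldNormedType.Exports.

Set Implicit Arguments.
Unset Strict Implicit.
Unset Printing Implicit Defensive.

Local Open Scope classical_set_scope.
Local Open Scope ring_scope.

Notation borelRV R d := (g_sigma_algebraType (@open 'rV[R]_d)).

Section euclidean_space.
Context (R : realType) (d : nat).
Implicit Types u v : 'rV[R]_d.

Definition dotmul u v : R := \sum_(i < d) u 0 i * v 0 i.

(* The library's norm on row vectors is the sup norm. *)
Definition enorm u : R := Num.sqrt (dotmul u u).

End euclidean_space.

Section lebesgue_tuple.
Context (R : realType).
Local Notation mR := (measurableTypeR R).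

Definition tuple_cons d (p : mR * d.-tuple mR) : d.+1.-tuple mR :=
  [tuple of p.1 :: p.2].

Definition tuple_uncons d (t : d.+1.-tuple mR) : mR * d.-tuple mR :=
  (tnth t ord0, [tuple of behead t]).

Lemma tuple_consK d : cancel (@tuple_cons d) (@tuple_uncons d).
Proof. by case=> a t; congr pair; apply/val_inj. Qed.

Lemma measurable_tuple_cons d : measurable_fun [set: _] (@tuple_cons d).
Proof. by apply: measurable_cons. Qed.

Lemma measurable_tuple_uncons d : measurable_fun [set: _] (@tuple_uncons d).
Proof.
by apply/measurable_fun_pair; [exact: measurable_tnth|exact: measurable_behead].
Qed.

Section cons_measure.
Context (d : nat).
Variable m : {sigma_finite_measure set (d.-tuple mR) -> \bar R}.

Definition cons_measure : set (d.+1.-tuple mR) -> \bar R :=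
  pushforward (@lebesgue_measure R \x m)%E (@tuple_cons d).

Let mcons : measurable_fun [set: _] (@tuple_cons d) := @measurable_tuple_cons d.

Let cons_measure0 : cons_measure set0 = 0%E.
Proof. exact: measure0. Qed.

Let cons_measure_ge0 A : (0 <= cons_measure A)%E.
Proof. exact: measure_ge0. Qed.

Let cons_measure_sigma_additive : semi_sigma_additive cons_measure.
Proof. exact: measure_semi_sigma_additive. Qed.

HB.instance Definition _ := isMeasure.Build _ _ _ cons_measure
  cons_measure0 cons_measure_ge0 cons_measure_sigma_additive.

Let cons_measure_sigma_finite : sigma_finite setT cons_measure.
Proof.
have /sigma_finiteP[G [TG ndG Gfin]] := sigma_finiteT m.
have /sigma_finiteP[F [TF ndF Ffin]] :=
  sigma_finiteT (@lebesgue_measure R).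
exists (fun k => @tuple_uncons d @^-1` (F k `*` G k)).
  rewrite -preimage_bigcup (_ : \bigcup_k _ = setT) ?preimage_setT//.
  rewrite -setXTT TF TG; apply/seteqP; split=> [[x y] [n _ []]|[x y]] /=.
    by move=> Fx Gy; split; exists n.
  move=> [[n _ Fnx] [k _ Gky]]; exists (maxn n k) => //; split.
  - by move: x Fnx; exact/subsetPset/ndF/leq_maxl.
  - by move: y Gky; exact/subsetPset/ndG/leq_maxr.
move=> k; have [mF Fk] := Ffin k; have [mG Gk] := Gfin k; split.
  rewrite -[X in measurable X]setTI; apply: measurable_tuple_uncons => //.
  exact: measurableX.
rewrite /cons_measure /pushforward -comp_preimage.
rewrite (_ : @tuple_uncons d \o @tuple_cons d = id); last first.
  by apply/funext => p; exact: tuple_consK.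
by rewrite preimage_id product_measure1E// lte_mul_pinfty// ge0_fin_numE.
Qed.

HB.instance Definition _ := Measure_isSigmaFinite.Build _ _ _ cons_measure
  cons_measure_sigma_finite.

End cons_measure.

Fixpoint lebesgue_tuple d : {sigma_finite_measure set (d.-tuple mR) -> \bar R} :=
  match d with
  | 0 => \d_([tuple] : 0.-tuple mR)
  | d'.+1 => cons_measure (lebesgue_tuple d')
  end.

End lebesgue_tuple.

Section lebesgue_rV.
Context (R : realType) (d : nat).
Local Notation mR := (measurableTypeR R).

Definition rV_of_tuple (t : d.-tuple mR) : borelRV R d := \row_i tnth t i.

Let boxq (p : 'rV[rat]_d * rat) : set 'rV[R]_d :=
  [set v | forall i, `|v 0 i - ratr (p.1 0 i)| < ratr p.2].

Let open_boxq (U : set 'rV[R]_d) : open U ->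
  U = \bigcup_(p in [set p | boxq p `<=` U]) boxq p.
Proof.
move=> oU; apply/seteqP; split=> [v Uv|v [p pU]]; last exact: pU.
have /nbhs_ballP[e /= e0 veU] : nbhs v U by apply: open_nbhs_nbhs.
have [q] : exists q : rat, ratr q \in `](0 : R), (e / 2)[.
  by apply: rat_in_itvoo; rewrite divr_gt0.
rewrite in_itv /= => /andP[q0 qe].
have qP (i : 'I_d) : exists r : rat, `|v 0 i - ratr r| < ratr q.
  have [r] : exists r : rat, ratr r \in `](v 0 i - ratr q), (v 0 i + ratr q)[.
    by apply: rat_in_itvoo; rewrite ltrD2l (lt_trans _ q0)// oppr_lt0.
  by rewrite in_itv /= => rv; exists r; rewrite distrC ltr_distl.
have [r rP] := choice qP.
exists (\row_i r i, q) => /=; last by move=> i; rewrite mxE.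
move=> w /= wr; apply: veU; split=> // i j; rewrite ord1 /ball /=.
rewrite (splitr e); apply: le_lt_trans (ler_distD (ratr (r j)) _ _) _.
apply: ltrD; apply: lt_trans qe; first exact: rP.
by rewrite distrC; have := wr j; rewrite mxE.
Qed.

Lemma measurable_rV_of_tuple : measurable_fun [set: _] rV_of_tuple.
Proof.
apply: (@measurability _ _ _ (borelRV R d) _ _ (@open 'rV[R]_d)) => //.
move=> _ [U oU <-].
rewrite setTI (open_boxq oU) bigcup_mkcond preimage_bigcup.
apply: countable_bigcupT_measurable => // p; case: ifPn => _; last by rewrite preimage_set0.
have -> : rV_of_tuple @^-1` boxq p =
    \bigcap_(i in [set: 'I_d]) (fun t : d.-tuple mR => tnth t i) @^-1`
      [set x | `|x - ratr (p.1 0 i)| < ratr p.2].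
  apply/seteqP; split=> t /= tp i => [_|]; first by have := tp i; rewrite mxE.
  by rewrite mxE; exact: tp.
apply: fin_bigcap_measurable => [|i _]; first exact: finite_finset.
rewrite -[X in measurable X]setTI; apply: measurable_tnth => //.
rewrite (_ : [set _ | _] = ball (ratr (p.1 0 i) : R) (ratr p.2)).
  by exact: measurable_realfun.measurable_ball.
by apply/seteqP; split=> x; rewrite /ball/= distrC.
Qed.

Definition lebesgue_rV : set (borelRV R d) -> \bar R :=
  pushforward (lebesgue_tuple R d) rV_of_tuple.

Let mrV : measurable_fun [set: _] rV_of_tuple := measurable_rV_of_tuple.

Let lebesgue_rV0 : lebesgue_rV set0 = 0%E.
Proof. exact: measure0. Qed.

Let lebesgue_rV_ge0 A : (0 <= lebesgue_rV A)%E.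
Proof. exact: measure_ge0. Qed.

Let lebesgue_rV_sigma_additive : semi_sigma_additive lebesgue_rV.
Proof. exact: measure_semi_sigma_additive. Qed.

HB.instance Definition _ := isMeasure.Build _ _ _ lebesgue_rV
  lebesgue_rV0 lebesgue_rV_ge0 lebesgue_rV_sigma_additive.

End lebesgue_rV.

Section total_variation.
Context {disp : measure_display} {T : measurableType disp} {R : realType}.
Variable nu : {charge set T -> \bar R}.

Let P := projT1 (cid (Hahn_decomposition nu)).
Let exN : exists N, hahn_decomposition nu P N :=
  projT2 (cid (Hahn_decomposition nu)).

(* The value does not depend on the Hahn decomposition
   (Hahn_decomposition_uniq). *)
Definition tv_norm : \bar R := charge_variation (projT2 (cid exN)) [set: T].

End total_variation.

Section weighted_dirac.
Context {disp : measure_display} {T : measurableType disp} {R : realType}.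
Variables (n : nat) (a : 'I_n -> R) (x : 'I_n -> T).

Definition weighted_dirac : {charge set T -> \bar R} :=
  \big[(fun m1 m2 => cadd m1 m2 : {charge set T -> \bar R})/
       (czero : {charge set T -> \bar R})]_(i < n)
    (cscale (a i) (charge_of_finite_measure \d_(x i))
      : {charge set T -> \bar R}).

Lemma weighted_diracE A :
  weighted_dirac A = (\sum_(i < n) (a i)%:E * \d_(x i) A)%E.
Proof.
by rewrite /weighted_dirac; elim/big_rec2 : _ => // i b m _ <-.
Qed.

End weighted_dirac.

Section complex_integral.
Context (R : realType).
Local Open Scope complex_scope.

Definition expi (t : R) : R[i] := cos t +i* sin t.

(* Meaningful when the real and imaginary parts of f are integrable. *)
Definition complex_integral {disp} {T : measurableType disp}
    (mu : {measure set T -> \bar R}) (f : T -> R[i]) : R[i] :=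
  (\int[mu]_u complex.Re (f u))%R +i* (\int[mu]_u complex.Im (f u))%R.

Definition has_spectral_density d (k : 'rV[R]_d -> 'rV[R]_d -> R)
    (S : 'rV[R]_d -> R) : Prop :=
  [/\ forall u, 0 <= S u,
      (@lebesgue_rV R d).-integrable [set: borelRV R d] (EFin \o S) &
      forall x y, (k x y)%:C = ((2 * pi) ^- d)%:C *
        complex_integral (@lebesgue_rV R d)
          (fun u => expi (dotmul u (x - y)) * (S u)%:C)].

End complex_integral.

Section kriging.
Context {disp : measure_display} {Omega : measurableType disp} {R : realType}.
Variable P : probability Omega R.

Definition linear_span n (Z : 'I_n -> Omega -> R) : set (Omega -> R) :=
  [set Y | exists c : 'I_n -> R, Y = fun w => \sum_(i < n) c i * Z i w].

Definition orthogonal_projection (V : set (Omega -> R)) (X Y : Omega -> R) :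
    Prop :=
  V Y /\ forall Z, V Z -> ('E_P[((X \- Y) \* Z)%R] = 0)%E.

Variables (d : nat) (xi : 'rV[R]_d -> {RV P >-> R}).

Definition second_order_process : Prop :=
  forall x, (xi x : Omega -> R) \in Lfun P 2%:E.

Definition zero_mean : Prop := forall x, ('E_P[xi x] = 0)%E.

Definition cov_fun (x y : 'rV[R]_d) : R := fine ('E_P[(xi x \* xi y)%R])%E.

Definition second_order_stationary : Prop :=
  forall x y x' y', x - y = x' - y' -> cov_fun x y = cov_fun x' y'.

(* [a] is a vector of coefficients of the kriging predictor of [xi x] from
   [xi (pts i)], [i < n].  It need not be unique (e.g. if a point is repeated). *)
Definition kriging_coefficients n (pts : 'I_n -> 'rV[R]_d) (x : 'rV[R]_d)
    (a : 'I_n -> R) : Prop :=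
  orthogonal_projection (linear_span (fun i => xi (pts i) : Omega -> R)) (xi x)
    (fun w => \sum_(i < n) a i * xi (pts i) w).

End kriging.

Section kriging_measure.
Context {R : realType} {d : nat}.
Variables (n : nat) (a : 'I_n -> R) (pts : 'I_n -> 'rV[R]_d).

Definition kriging_measure : {charge set (borelRV R d) -> \bar R} :=
  weighted_dirac a (pts : 'I_n -> borelRV R d).

Definition pairing (f : 'rV[R]_d -> R) : R := \sum_(i < n) a i * f (pts i).

End kriging_measure.

(* Main.v *)
(* Write lambda_n for the kriging measure at x.

   If lambda_n(f) converges for every continuous f, then a gliding hump argument
   bounds the total variation: it is attained, up to interpolation, at a
   continuous function with values in [-1, 1] that takes prescribed signs at the
   data points.

   Conversely, let the total variations be bounded by M.  The mean square error
   of the predictor is at most E(xi(x) - xi(x_j))^2 for every j <= n, hence tends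
   to 0 because x is in the closure of the data points.  Spectrally, it is the
   integral of |phi_n|^2 S, where phi_n(u) = exp(i u.x) - lambda_n(exp(i u.)).
   The bound M makes the phi_n equi-Lipschitz and S > 0 almost everywhere, so
   phi_n tends to 0 at every single frequency: lambda_n(f) tends to f(x) for
   every trigonometric polynomial f.  By Stone-Weierstrass these are uniformly
   dense on compact sets, and the bound M transfers the convergence to all
   continuous functions. *)
Require Import Defs.
From mathcomp Require Import all_boot all_order all_algebra.
From mathcomp Require Import ring lra complex.
From mathcomp Require Import all_classical all_reals all_analysis.
Import Order.TTheory GRing.Theory Num.Theory.
Import numFieldNormedType.Exports.

Set Implicit Arguments.
Unset Strict Implicit.
Unset Printing Implicit Defensive.

Local Open Scope classical_set_scope.
Local Open Scope ring_scope.

(** * Total variation of finitely supported measures *)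

Section total_variation_pairing.
Context (R : realType) (d n : nat).
Variables (a : 'I_n -> R) (x : 'I_n -> 'rV[R]_d).

Lemma measurable_set1_rV (p : 'rV[R]_d) : measurable ([set p] : set (borelRV R d)).
Proof.
rewrite -(setCK [set p]); apply: measurableC; apply: sub_sigma_algebra.
apply: closed_openC; apply: accessible_closed_set1.
exact/hausdorff_accessible/norm_hausdorff.
Qed.

Lemma kriging_measureE (A : set (borelRV R d)) :
  kriging_measure a x A = (\sum_(i < n) a i * \1_A (x i))%:E.
Proof.
rewrite /kriging_measure weighted_diracE -sumEFin.
by apply: eq_bigr => i _; rewrite diracE EFinM indicE.
Qed.

(** Points may repeat, and the total variation only sees masses after equal points have been merged;
    this is the merged mass at [p]. *)
Definition atom (p : 'rV[R]_d) : R := \sum_(i < n | x i == p) a i.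

Lemma kriging_measure_set1 p : kriging_measure a x [set p] = (atom p)%:E.
Proof.
rewrite kriging_measureE; congr EFin; rewrite /atom [RHS]big_mkcond.
apply: eq_bigr => i _; rewrite indicE; case: eqP => [->|/eqP xip].
  by rewrite mem_set ?mulr1.
by rewrite memNset ?mulr0// => /= xpi; rewrite xpi eqxx in xip.
Qed.

Lemma pairing_atoms (f : 'rV[R]_d -> R) :
  pairing a x f = \sum_(p <- undup (map x (enum 'I_n))) f p * atom p.
Proof.
under [RHS]eq_bigr do rewrite /atom mulr_sumr.
rewrite (exchange_big_dep predT)//=; apply: eq_bigr => i _.
rewrite -big_filter (_ : [seq _ <- _ | _] = [:: x i]) ?big_seq1 1?mulrC//.
rewrite (@eq_filter _ _ (pred1 (x i))); last by move=> p /=; rewrite eq_sym.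
apply: filter_pred1_uniq; rewrite ?undup_uniq// mem_undup.
by apply: map_f; rewrite mem_enum.
Qed.

(* The sign function is the difference of the indicators of a Hahn
   decomposition. *)
Lemma tv_norm_sign : exists s : 'rV[R]_d -> R,
  [/\ forall y, `|s y| = 1, forall y, 0 <= s y * atom y &
      tv_norm (kriging_measure a x) = (pairing a x s)%:E].
Proof.
rewrite /tv_norm; set P := projT1 _; case: (cid _) => N /= PN.
have [[mP posP] [mN negN] PNT PN0] := PN.
exists (fun y => \1_P y - \1_N y).
have sE (y : 'rV[R]_d) : (y \in P /\ y \notin N) \/ (y \notin P /\ y \in N).
  have [Py|Py] := boolP (y \in P).
    left; split=> //; apply/negP => Ny.
    have : (P `&` N) y by split; exact/set_mem.
    by rewrite PN0.
  right; split => //.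
  have : (P `|` N) y by rewrite PNT.
  by case=> [/mem_set|/mem_set //]; rewrite (negPf Py).
split.
- move=> y; rewrite !indicE.
  by have [[-> /negPf->]|[/negPf-> ->]] := sE y;
    rewrite ?subr0 ?sub0r ?normrN normr1.
- move=> y; rewrite -lee_fin EFinM -kriging_measure_set1.
  have my := measurable_set1_rV y.
  have [[Py Ny]|[Py Ny]] := sE y; rewrite !indicE.
    rewrite Py (negPf Ny) subr0 mul1e; apply: posP => // _ ->; exact/set_mem.
  rewrite (negPf Py) Ny sub0r EFinN mulN1e leeNr oppe0; apply: negN => // _ ->.
  exact/set_mem.
- rewrite /charge_variation jordan_posE jordan_negE cjordan_posE cjordan_negE.
  rewrite /crestr0 mem_set//= /crestr !setTI !kriging_measureE -EFinN -EFinD.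
  congr EFin; rewrite -sumrB; apply: eq_bigr => i _; ring.
Qed.

Lemma tv_norm_fin : tv_norm (kriging_measure a x) \is a fin_num.
Proof. by have [s [_ _ ->]] := tv_norm_sign. Qed.

(** After merging equal points, each term is at most [C * |atom p|], and [|atom p| = s p * atom p]
    for the sign function [s]. Summation gives [C] times the total variation. *)
Lemma pairing_tv (f : 'rV[R]_d -> R) (C : R) : (forall i, `|f (x i)| <= C) ->
  `|pairing a x f| <= C * fine (tv_norm (kriging_measure a x)).
Proof.
move=> fC; have [s [s1 s0 ->]] := tv_norm_sign.
rewrite /= !pairing_atoms mulr_sumr (le_trans (ler_norm_sum _ _ _))//.
rewrite !big_seq; apply: ler_sum => p; rewrite mem_undup => /mapP[i _ ->].
rewrite normrM ler_pM//; rewrite -[leLHS]mul1r -(s1 (x i)) -normrM ger0_norm//.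
Qed.

End total_variation_pairing.

(** * Uniform boundedness *)

Section uniform_boundedness.
Context (R : realType) (X : topologicalType).

Lemma uniform_approx_continuous (f : X -> R) :
  (forall e, 0 < e -> exists2 g : X -> R, continuous g &
     forall y, `|f y - g y| <= e) -> continuous f.
Proof.
move=> fg y; apply/cvgrPdist_lt => e e0.
have [|g cg fge] := fg (e / 3); first by rewrite divr_gt0.
have := cg y => /cvgrPdist_lt /(_ (e / 3)) => /(_ ltac:(by rewrite divr_gt0)).
apply: filterS => z gyz.
have := fge y; have := fge z.
rewrite (_ : f y - f z = (f y - g y) + (g y - g z) - (f z - g z)); last by ring.
move=> fgz fgy; rewrite (le_lt_trans (ler_normB _ _))//.
have := ler_normD (f y - g y) (g y - g z); lra.
Qed.

Lemma geometric_uniform_limit (f_ : nat -> X -> R) :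
  (forall j, continuous (f_ j)) ->
  (forall j y, `|f_ j.+1 y - f_ j y| <= 3 ^- j) ->
  exists2 f : X -> R, continuous f & forall j y, `|f y - f_ j y| <= 3 / 2 * 3 ^- j.
Proof.
(* [e j] is the tail of the series of [3^-i] over [i >= j], so the intervals of radius [e j] around
   [f_ j y] are nested. The limit is the supremum of their left ends. *)
move=> cf df; pose e j : R := 3 / 2 * 3 ^- j.
have eS j : e j.+1 = e j / 3.
  by rewrite /e exprS invfM; field; rewrite expf_neq0.
have e0 j : 0 < e j by rewrite mulr_gt0// invr_gt0 exprn_gt0.
have lo y : nondecreasing_seq (fun j => f_ j y - e j).
  apply/nondecreasing_seqP => j; have := df j y; rewrite eS ler_norml => /andP[+ _].
  by rewrite (_ : 3 ^- j = 2 / 3 * e j) /e; [lra|field; rewrite expf_neq0].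
have hi y : nonincreasing_seq (fun j => f_ j y + e j).
  apply/nonincreasing_seqP => j; have := df j y; rewrite eS ler_norml => /andP[_ +].
  by rewrite (_ : 3 ^- j = 2 / 3 * e j) /e; [lra|field; rewrite expf_neq0].
have lohi y i j : f_ i y - e i <= f_ j y + e j.
  apply: (le_trans (lo y _ _ (leq_maxl i j))).
  apply: le_trans (hi y _ _ (leq_maxr i j)).
  by rewrite lerD2l ge0_cp// ltW.
pose f y := sup (range (fun j => f_ j y - e j)).
have ff j y : `|f y - f_ j y| <= e j.
  rewrite ler_distl; apply/andP; split.
    apply: ub_le_sup; last by exists j.
    by exists (f_ 0 y + e 0) => _ [i _ <-].
  by apply: ge_sup => [|_ [i _ <-]//]; exists (f_ 0 y - e 0); exists 0.
exists f => //; apply: uniform_approx_continuous => eps eps0.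
suff [j ej] : exists j, e j <= eps.
  by exists (f_ j) => // y; exact: le_trans (ff j y) ej.
have ecvg : e @ \oo --> (0 : R).
  rewrite -(mulr0 (3 / 2 : R)); apply: cvgMr; under eq_fun do rewrite -exprVn.
  by apply: cvg_expr; rewrite ger0_norm ?invr_ge0// invf_lt1// ltr1n.
move/cvgrPdist_le : ecvg => /(_ _ eps0)[j _ /(_ j (leqnn j))].
by rewrite /= sub0r normrN gtr0_norm//; exists j.
Qed.

(** [L k] stands for a linear functional and [N k] for its norm, attained at a continuous function
    bounded by 1. *)
Variables (L : nat -> (X -> R) -> R) (N : nat -> R).
Hypothesis LD : forall k f g (c : R),
  L k (fun y => f y + c * g y) = L k f + c * L k g.
Hypothesis LN : forall k f (C : R), (forall y, `|f y| <= C) -> `|L k f| <= N k * C.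
Hypothesis L_attained : forall k, exists g : X -> R,
  [/\ continuous g, forall y, `|g y| <= 1 & L k g = N k].

(* Gliding hump: the terms of the series [f = sum_j +- 3^-j g_j] are chosen
   successively so that the [j]-th one makes [L (k j)] large while the
   remaining tail, being at most half as big, cannot compensate. *)
Lemma uniform_boundedness :
  (forall f : X -> R, continuous f -> exists B : R, forall k, `|L k f| <= B) ->
  exists B : R, forall k, N k <= B.
Proof.
move=> bL; apply: contrapT => /forallNP NB.
(* The growth [4^j] outweighs the factor [3^-j] carried by the [j]-th hump. *)
have N_large (j : nat) : exists k, 4 ^+ j <= N k.
  have /existsNP[k /negP] := NB (4 ^+ j); rewrite -ltNge => /ltW; by exists k.
have [k kN] := choice N_large.
have [g gP] := choice L_attained.
have pick_sign (j : nat) (f : X -> R) : exists c : R, `|c| = 1 /\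
    3 ^- j * N (k j) <= `|L (k j) (fun y => f y + c * 3 ^- j * g (k j) y)|.
  have [_ _ gk] := gP (k j); set t := 3 ^- j * N (k j).
  (* Giving the hump the sign of [L (k j) f] excludes cancellation. *)
  have [Lf|Lf] := leP 0 (L (k j) f).
    exists 1; rewrite normr1 mul1r LD gk; split => //.
    by rewrite (le_trans _ (ler_norm _))// lerDr.
  exists (-1); rewrite normrN1 LD gk mulN1r mulNr; split => //.
  rewrite -normrN (le_trans _ (ler_norm _))// -/t opprD opprK lerDr oppr_ge0.
  exact: ltW.
have [c cP] := choice (fun jf : nat * (X -> R) => pick_sign jf.1 jf.2).
pose f_ := fix f_ j := match j with
  | 0 => fun=> 0
  | j.+1 => fun y => f_ j y + c (j, f_ j) * 3 ^- j * g (k j) y end.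
have cf j : continuous (f_ j).
  elim: j => [|j IH] y /=; first exact: cvg_cst.
  apply: cvgD; first exact: IH.
  by apply: cvgMr; have [cg _ _] := gP (k j); exact: cg.
have df j y : `|f_ j.+1 y - f_ j y| <= 3 ^- j.
  rewrite /= addrC addKr !normrM; have [-> _] := cP (j, f_ j); rewrite mul1r.
  rewrite ger0_norm ?invr_ge0 ?exprn_ge0// ler_piMr ?invr_ge0 ?exprn_ge0//.
  by have [_ + _] := gP (k j); apply.
have [f fcont ff] := geometric_uniform_limit cf df.
have [B LB] := bL f fcont.
(* The partial sum contributes at least [3^-j * N (k j)] to [L (k j) f] and the tail cancels at most
   half of it, so half of [(4/3)^j] stays below [B]. *)
have large (j : nat) : (4 / 3) ^+ j <= 2 * B.
  have := cP (j, f_ j) => -[_]; rewrite -[fun _ => _]/(f_ j.+1) => big.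
  have := LN (k j) (ff j.+1).
  have -> : L (k j) (fun y => f y - f_ j.+1 y) = L (k j) f - L (k j) (f_ j.+1).
    have := LD (k j) f (f_ j.+1) (-1); rewrite mulN1r => <-; congr L.
    by apply/funext => y; rewrite mulN1r.
  have -> : 3 / 2 * 3 ^- j.+1 = 3 ^- j / 2 :> R.
    by rewrite exprS invfM; field; rewrite expf_neq0.
  move=> small; have := LB (k j).
  have : (4 / 3) ^+ j <= 3 ^- j * N (k j).
    by rewrite exprMn exprVn mulrC ler_pM2l ?invr_gt0 ?exprn_gt0.
  have := ler_distD (L (k j) f) (L (k j) (f_ j.+1)) 0; rewrite !subr0 distrC.
  move: big small; rewrite mulrA [N _ * _]mulrC; lra.
have : (fun j => (3 / 4 : R) ^+ j) @ \oo --> (0 : R).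
  by apply: cvg_expr; rewrite ger0_norm//; lra.
have B0 : 0 < 2 * B by rewrite (lt_le_trans _ (large 0)).
move/cvgrPdist_lt => /(_ (2 * B)^-1); rewrite invr_gt0.
move=> /(_ B0)[j _ /(_ j (leqnn j))].
rewrite /= sub0r normrN ger0_norm ?exprn_ge0//.
rewrite -(ltf_pV2 (x := (2 * B)^-1)) ?posrE ?invr_gt0 ?exprn_gt0//.
rewrite invrK -exprVn invf_div => /(le_lt_trans (large j)).
by rewrite ltxx.
Qed.

End uniform_boundedness.

(** * Continuous functions with prescribed signs at finitely many points *)

Section continuous_extrema.
Context (R : realType) (X : topologicalType) (f g : X -> R).

Lemma continuous_maxr : continuous f -> continuous g ->
  continuous (fun y => Num.max (f y) (g y)).
Proof.
by move=> cf cg y; have h := @continuous_max R X f g y (cf y) (cg y); exact: h.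
Qed.

Lemma continuous_minr : continuous f -> continuous g ->
  continuous (fun y => Num.min (f y) (g y)).
Proof.
by move=> cf cg y; have h := @continuous_min R X f g y (cf y) (cg y); exact: h.
Qed.

End continuous_extrema.

Section interpolation.
Context (R : realType) (V : normedModType R) (n : nat) (x : 'I_n -> V).

(* The tent functions around two distinct points [x i] and [x j] vanish at
   each other's center since [M * `|x i - x j| >= 1]; when a point is repeated
   its tents add up, hence the truncation to [-1, 1]. *)
Lemma sign_interpolation (s : V -> R) : (forall y, `|s y| = 1) ->
  exists g : V -> R,
    [/\ continuous g, forall y, `|g y| <= 1 & forall i, g (x i) = s (x i)].
Proof.
(* Since the inverse of 0 is 0, coinciding points contribute nothing, and [M] dominates the inverse
   distance of every pair of distinct points. *)
move=> s1; pose M : R := \sum_i \sum_j `|x i - x j|^-1.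
have M0 i j : 0 <= `|x i - x j|^-1 by rewrite invr_ge0.
pose tent i (y : V) : R := Num.max (1 - M * `|y - x i|) 0.
have tent_ge0 i y : 0 <= tent i y by rewrite le_max lexx orbT.
have tent_center i : tent i (x i) = 1.
  by rewrite /tent subrr normr0 mulr0 subr0 max_l.
have tent_off i j : x j != x i -> tent i (x j) = 0.
  move=> xji; rewrite /tent max_r// subr_le0.
  have nji : 0 < `|x j - x i| by rewrite normr_gt0 subr_eq0.
  rewrite -ler_pdivrMr// mul1r /M (bigD1 j)//= (bigD1 i)//= -addrA lerDl.
  by rewrite addr_ge0 ?sumr_ge0// => k _; rewrite sumr_ge0.
have tent_cont i : continuous (tent i).
  have := @continuous_maxr R _ (fun y : V => 1 - M * `|y - x i|) (fun=> 0).
  apply; last exact: cst_continuous.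
  move=> y.
  apply: cvgB; first exact: cvg_cst.
  by apply: cvgMr; apply: cvg_norm; apply: cvgB; [exact: cvg_id|exact: cvg_cst].
pose h (y : V) : R := \sum_i s (x i) * tent i y.
exists (fun y => Num.max (Num.min (h y) 1) (-1)); split.
- have := @continuous_maxr R _ (fun y : V => Num.min (h y) 1) (fun=> -1).
  apply; last exact: cst_continuous.
  move=> y.
  have := @continuous_minr R _ h (fun=> 1).
  apply; last exact: cst_continuous.
  move=> {}y.
  apply: cvg_big => [|i _]; [exact: add_continuous|apply: cvgMr; exact: tent_cont].
- move=> y; rewrite ler_norml le_max lexx orbT ge_max ge_min lexx orbT/=; lra.
- move=> i; set k := \sum_(j | x j == x i) 1 : R.
  have -> : h (x i) = s (x i) * k.
    rewrite /h /k mulr_sumr [RHS]big_mkcond; apply: eq_bigr => j _.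
    case: eqP => [<-|/eqP xji]; last by rewrite tent_off ?mulr0// eq_sym.
    by rewrite tent_center.
  have k1 : 1 <= k.
    by rewrite /k (bigD1 i)//= lerDl sumr_ge0.
  have := s1 (x i); have [s0|s0] := leP 0 (s (x i)).
    rewrite ger0_norm// => ->; rewrite mul1r min_r// max_l//; lra.
  rewrite ltr0_norm// => sN1; rewrite -[s (x i)]opprK sN1 mulN1r.
  by rewrite min_l ?max_r//; lra.
Qed.

End interpolation.

(** Uniform boundedness applies with the total variation as norm of the pairing: a continuous
    interpolation of the Hahn signs at the data points attains it. *)
Lemma bounded_tv_norm (R : realType) (d : nat) (m : nat -> nat)
    (a : forall k, 'I_(m k) -> R) (x : forall k, 'I_(m k) -> 'rV[R]_d) :
  (forall f : 'rV[R]_d -> R, continuous f ->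
     exists B : R, forall k, `|pairing (a k) (x k) f| <= B) ->
  exists B : R, forall k, (tv_norm (kriging_measure (a k) (x k)) <= B%:E)%E.
Proof.
move=> bf; pose N k := fine (tv_norm (kriging_measure (a k) (x k))).
have NE k : tv_norm (kriging_measure (a k) (x k)) = (N k)%:E.
  by rewrite fineK// tv_norm_fin.
suff [B NB] : exists B : R, forall k, N k <= B.
  by exists B => k; rewrite NE lee_fin.
apply: (@uniform_boundedness _ _ (fun k => pairing (a k) (x k))) => //.
- move=> k f g c; rewrite /pairing mulr_sumr -big_split; apply: eq_bigr => i _ /=.
  by ring.
- by move=> k f C fC; rewrite mulrC; exact: pairing_tv.
- move=> k; have [s [s1 _ tvE]] := tv_norm_sign (a k) (x k).
  have [g [cg g1 gs]] := @sign_interpolation _ _ _ (x k) s s1.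
  exists g; split => //; rewrite /N tvE /=.
  by apply: eq_bigr => i _; rewrite gs.
Qed.

(** * Stone-Weierstrass theorem *)

Lemma bigmax_ler (R : realType) (I : eqType) (s : seq I) (F : I -> R) (m c : R) :
  m <= c -> (forall i, i \in s -> F i <= c) ->
  \big[Num.max/m]_(i <- s) F i <= c.
Proof.
move=> mc Fc; rewrite big_seq; elim/big_ind : _ => // x y.
by rewrite ge_max => -> ->.
Qed.

Lemma ler_bigmax_seq (R : realType) (I : eqType) (s : seq I) (F : I -> R) (m : R) i :
  i \in s -> F i <= \big[Num.max/m]_(i <- s) F i.
Proof.
elim: s => // j s IH; rewrite inE big_cons le_max => /predU1P[->|/IH ->].
  by rewrite lexx.
by rewrite orbT.
Qed.

(* The recursion [u := u + (t^2 - u^2) / 2] approximates [|t|] by polynomials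
   in [t] on [-1, 1]. *)
Fixpoint abs_iter (R : realType) (n : nat) (t : R) : R :=
  if n is m.+1 then
    let u := abs_iter m t in u + 2^-1 * (t * t + (-1) * (u * u))
  else 0.

(** One iteration multiplies the error [e = |t| - u] by [1 - (|t| + u) / 2], which is at most
    [1 - e / 2]. As [x * (1 - x / 2)] increases up to [x = 1], a bound [2 / N] becomes
    [2 / N * (1 - 1 / N)], below [2 / (N + 1)]. The start [N = 2] expresses [|t| <= 1]. The rate is
    uniform in [t]. *)
Lemma abs_iter_bounds (R : realType) (n : nat) (t : R) : `|t| <= 1 ->
  0 <= abs_iter n t <= `|t| /\ `|t| - abs_iter n t <= 2 / n.+2%:R.
Proof.
move=> t1; elim: n => [|n [/andP[u0 ut] ih]] /=.
  by rewrite lexx normr_ge0 subr0 divff.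
set u := abs_iter n t in u0 ut ih *; set a := `|t| in t1 ut ih *.
have -> : t * t = a * a by rewrite -normrM ger0_norm// -expr2 sqr_ge0.
have u2 : u * u <= a * a by rewrite ler_pM.
have -> : a - (u + 2^-1 * (a * a + -1 * (u * u))) = (a - u) * (1 - (a + u) / 2).
  by field.
have au : (a + u) / 2 <= 1 by rewrite ler_pdivrMr// mul1r; lra.
split; first apply/andP; [split|].
- by rewrite addr_ge0// mulr_ge0// mulN1r subr_ge0.
- rewrite -subr_ge0 (_ : _ - _ = (a - u) * (1 - (a + u) / 2)); last by field.
  by rewrite mulr_ge0 ?subr_ge0.
- set e := a - u in ih *.
  have e0 : 0 <= e by rewrite subr_ge0.
  apply: (@le_trans _ _ (e * (1 - e / 2))).
    by rewrite ler_wpM2l// lerD2l lerN2 ler_wpM2r// /e; lra.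
  set N : R := n.+2%:R in ih *.
  have N2 : 2 <= N by rewrite ler_nat.
  have N0 : N != 0 by rewrite gt_eqF//; lra.
  have -> : n.+3%:R = N + 1 :> R by rewrite -natr1.
  apply: (@le_trans _ _ (2 / N * (1 - N^-1))).
    have mono (x y : R) : x <= y -> y <= 1 -> x * (1 - x / 2) <= y * (1 - y / 2).
      move=> xy y1; rewrite -subr_ge0.
      rewrite (_ : _ - _ = (y - x) * (1 - (x + y) / 2)); last by field.
      by rewrite mulr_ge0 ?subr_ge0//; lra.
    rewrite (_ : 1 - N^-1 = 1 - 2 / N / 2); last by field.
    by apply: mono => //; rewrite ler_pdivrMr ?mul1r//; lra.
  rewrite ler_pdivlMr; last lra.
  rewrite (_ : _ * _ = 2 * (1 - N^-2)); last by field.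
  by rewrite -[leRHS]mulr1 ler_wpM2l// gerBl invr_ge0 exprn_ge0//; lra.
Qed.

Section stone_weierstrass.
Context (R : realType) (X : ptopologicalType) (K : set X) (A : set (X -> R)).
Hypothesis cptK : compact K.
Hypothesis A_continuous : forall f, A f -> continuous f.
Hypothesis A_cst : forall c, A (fun=> c).
Hypothesis AD : forall f g, A f -> A g -> A (fun y => f y + g y).
Hypothesis AM : forall f g, A f -> A g -> A (fun y => f y * g y).
Hypothesis A_separates : forall p q, K p -> K q -> p != q ->
  exists2 f, A f & f p != f q.

(** Approximation is required on [K] only, but continuity on all of [X], so that strict inequalities
    between members define open sets. *)
Definition uniform_closure (f : X -> R) : Prop := continuous f /\
  forall e, 0 < e -> exists2 g, A g & forall y, K y -> `|f y - g y| <= e.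
Local Notation B := uniform_closure.

Lemma continuous_bounded (f : X -> R) : continuous f ->
  exists2 C, 0 < C & forall y, K y -> `|f y| <= C.
Proof.
move=> cf.
have /compact_bounded[C0 [_ C0P]] : compact (f @` K).
  by apply: continuous_compact => //; exact: continuous_subspaceT.
exists (Num.max C0 0 + 1); first by rewrite ltr_wpDl// le_max lexx orbT.
move=> y Ky; apply: C0P; last by exists y.
by rewrite (@le_lt_trans _ _ (Num.max C0 0))// ?ltrDl// le_max lexx.
Qed.

Lemma uniform_closure_sub f : A f -> B f.
Proof.
move=> Af; split; first exact: A_continuous.
by move=> e e0; exists f => // y _; rewrite subrr normr0 ltW.
Qed.

Lemma uniform_closureD f g : B f -> B g -> B (fun y => f y + g y).
Proof.
move=> [cf Af] [cg Ag]; split=> [y|e e0].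
  by apply: cvgD; [exact: cf|exact: cg].
have e2 : 0 < e / 2 by rewrite divr_gt0.
have [f1 Af1 ff1] := Af _ e2; have [g1 Ag1 gg1] := Ag _ e2.
exists (fun y => f1 y + g1 y); first exact: AD.
move=> y Ky; rewrite (splitr e) opprD addrACA (le_trans (ler_normD _ _))//.
by rewrite lerD ?ff1 ?gg1.
Qed.

Lemma uniform_closureM f g : B f -> B g -> B (fun y => f y * g y).
Proof.
move=> [cf Af] [cg Ag]; split=> [y|e e0].
  by apply: cvgM; [exact: cf|exact: cg].
have [C C0 fC] := continuous_bounded cf.
have [C' C'0 gC'] := continuous_bounded cg.
have [f1 Af1 ff1] : exists2 f1, A f1 & forall y, K y -> `|f y - f1 y| <= e / 2 / C'.
  by apply: Af; rewrite !divr_gt0.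
have [C1 C10 fC1] := continuous_bounded (A_continuous Af1).
have [g1 Ag1 gg1] : exists2 g1, A g1 & forall y, K y -> `|g y - g1 y| <= e / 2 / C1.
  by apply: Ag; rewrite !divr_gt0.
exists (fun y => f1 y * g1 y); first exact: AM.
move=> y Ky.
rewrite (_ : _ - _ = (f y - f1 y) * g y + f1 y * (g y - g1 y)); last by ring.
rewrite (le_trans (ler_normD _ _))// !normrM (splitr e) lerD//.
  apply: (@le_trans _ _ (e / 2 / C' * C')); first by rewrite ler_pM ?ff1 ?gC'.
  by rewrite divfK ?gt_eqF.
apply: (@le_trans _ _ (C1 * (e / 2 / C1))); first by rewrite ler_pM ?gg1 ?fC1.
by rewrite [C1 * _]mulrC divfK ?gt_eqF.
Qed.

Lemma uniform_closureZ c f : B f -> B (fun y => c * f y).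
Proof. exact/uniform_closureM/uniform_closure_sub. Qed.

Lemma uniform_closureB f g : B f -> B g -> B (fun y => f y - g y).
Proof.
move=> Bf Bg; rewrite (_ : (fun _ => _) = fun y => f y + (-1) * g y).
  by apply: uniform_closureD => //; exact: uniform_closureZ.
by apply/funext => y; rewrite mulN1r.
Qed.

(** Scaling by a bound [C] of [|f|] on [K] brings the values into [-1, 1], where [abs_iter] gives
    polynomials in [f] converging uniformly to [|f|]. *)
Lemma uniform_closure_norm f : B f -> B (fun y => `|f y|).
Proof.
move=> Bf; have [cf _] := Bf; split=> [y|e e0].
  by apply: cvg_norm; exact: cf.
have [C C0 fC] := continuous_bounded cf.
have Bu n : B (fun y => C * abs_iter n (C^-1 * f y)).
  apply: uniform_closureZ; elim: n => [|n IH] /=; first exact: uniform_closure_sub.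
  apply: uniform_closureD => //; apply: uniform_closureZ.
  apply: uniform_closureD; first by apply: uniform_closureM; exact: uniform_closureZ.
  by apply: uniform_closureZ; exact: uniform_closureM.
have [n nC] : exists n, 2 / n.+2%:R <= e / 2 / C.
  have d0 : 0 < e / 2 / C / 2 by rewrite !divr_gt0.
  have [n _ /(_ n (leqnn n))] := near_infty_natSinv_lt (PosNum d0).
  rewrite /= => nd; exists n; rewrite mulrC -ler_pdivlMr// (le_trans _ (ltW nd))//.
  by rewrite lef_pV2 ?posrE ?ltr0n// ler_nat.
have e2 : 0 < e / 2 by rewrite divr_gt0.
have [_ /(_ _ e2)[g Ag ug]] := Bu n.
exists g => // y Ky; rewrite (splitr e).
rewrite (le_trans (ler_distD (C * abs_iter n (C^-1 * f y)) _ _))// lerD ?ug//.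
have t1 : `|C^-1 * f y| <= 1.
  by rewrite normrM gtr0_norm ?invr_gt0// mulrC ler_pdivrMr// mul1r fC.
have [/andP[u0 ut] ue] := abs_iter_bounds n t1.
have -> : `|f y| = C * `|C^-1 * f y|.
  by rewrite normrM gtr0_norm ?invr_gt0// mulVKf ?gt_eqF.
rewrite -mulrBr normrM gtr0_norm// ger0_norm ?subr_ge0//.
by rewrite mulrC -ler_pdivlMr// (le_trans ue).
Qed.

Lemma uniform_closure_max f g : B f -> B g -> B (fun y => Num.max (f y) (g y)).
Proof.
move=> Bf Bg.
rewrite (_ : (fun _ => _) = fun y => 2^-1 * (f y + g y + `|f y - g y|)).
  apply: uniform_closureZ; apply: uniform_closureD; first exact: uniform_closureD.
  by apply: uniform_closure_norm; exact: uniform_closureB.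
by apply/funext => y; rewrite maxr_absE mulrC.
Qed.

Lemma uniform_closure_bigmax (I : eqType) (s : seq I) (G : I -> X -> R) (m : R) :
  (forall i, i \in s -> B (G i)) -> B (fun y => \big[Num.max/m]_(i <- s) G i y).
Proof.
elim: s => [|i s IH] BG.
  rewrite (_ : (fun _ => _) = fun=> m); first exact: uniform_closure_sub.
  by apply/funext => y; rewrite big_nil.
rewrite (_ : (fun _ => _) =
  fun y => Num.max (G i y) (\big[Num.max/m]_(i <- s) G i y)).
  apply: uniform_closure_max; first by apply: BG; rewrite mem_head.
  by apply: IH => j js; apply: BG; rewrite inE js orbT.
by apply/funext => y; rewrite big_cons.
Qed.

(** The open sets where [G q] exceeds [f - e] cover [K], and [h] is the maximum of the [G q] over a
    finite subcover. The value [m] starts this maximum, hence the condition [m <= c]. *)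
Lemma compact_upper_envelope (f : X -> R) (G : X -> X -> R) (e m : R) :
  continuous f -> (forall q, K q -> B (G q) /\ f q - e < G q q) ->
  exists h, [/\ B h, forall y, K y -> f y - e < h y &
    forall y c, m <= c -> (forall q, K q -> G q y <= c) -> h y <= c].
Proof.
move=> cf GP.
have cov : cover_compact K by rewrite -compact_cover.
have := cov X K (fun q => [set y | 0 < G q y + e - f y]).
case=> [q Kq|y Ky|D DK KD].
- have [[cG _] _] := GP q Kq.
  apply: (@open_comp _ _ (fun y => G q y + e - f y) [set r | 0 < r]);
    last exact: open_gt.
  move=> y _; apply: cvgB; last exact: cf.
  by apply: cvgD; [exact: cG|exact: cvg_cst].
- by exists y => //=; have [_] := GP y Ky; lra.
exists (fun y => \big[Num.max/m]_(q <- finmap.enum_fset D) G q y); split.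
- by apply: uniform_closure_bigmax => q /DK /set_mem /GP[].
- move=> y /KD[q qD] /= Gq; apply: (@lt_le_trans _ _ (G q y)); first lra.
  exact: (@ler_bigmax_seq _ _ _ (G^~ y)).
- by move=> y c mc Gc; apply: bigmax_ler => // q /DK /set_mem; exact: Gc.
Qed.

(** Members of [A] interpolate [f] at any two points [p] and [q]. For fixed [p], an upper envelope
    over [q] stays above [f - e / 2] on [K] without exceeding [f] at [p]. The same envelope applied
    to the negatives, over [p], gives the bound from the other side. *)
Theorem stone_weierstrass (f : X -> R) : continuous f ->
  forall e, 0 < e -> exists2 g, A g & forall y, K y -> `|f y - g y| <= e.
Proof.
move=> cf e e0; have [M M0 fM] := continuous_bounded cf.
(* The membership conditions sit inside the existential so that choice yields a total function;
   outside [K] the witness is a dummy. *)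
have interp p q : exists g, K p -> K q -> [/\ A g, g p = f p & g q = f q].
  have [Kp|] := pselect (K p); last by exists f.
  have [Kq|] := pselect (K q); last by exists f.
  have [<-|pq] := eqVneq p q; first by exists (fun=> f p) => _ _; split.
  have [h Ah hpq] := A_separates Kp Kq pq.
  exists (fun y => f p + ((f q - f p) / (h q - h p)) * (h y + - h p)) => _ _; split.
  - by apply: AD => //; apply: AM => //; exact: AD.
  - by rewrite subrr mulr0 addr0.
  - by rewrite divfK ?subr_eq0 1?eq_sym// addrC subrK.
have [G GP] := choice (fun pq : X * X => interp pq.1 pq.2).
have e2 : 0 < e / 2 by rewrite divr_gt0.
have over p : exists h, K p ->
    [/\ B h, forall y, K y -> f y - e / 2 < h y & h p <= f p].
  have [Kp|] := pselect (K p); last by exists f.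
  have [|h [Bh fh hc]] :=
    @compact_upper_envelope f (fun q => G (p, q)) (e / 2) (- M) cf.
    move=> q Kq; have [AG _ ->] := GP (p, q) Kp Kq.
    by split; [exact: uniform_closure_sub|rewrite ltrBlDr ltrDl].
  exists h => _; split=> //; apply: hc.
    by have := fM _ Kp; rewrite ler_norml => /andP[].
  by move=> q Kq; have [_ /= -> _] := GP (p, q) Kp Kq.
have [H HP] := choice over.
have [||h [Bh fh hc]] :=
  @compact_upper_envelope (fun y => - f y) (fun p y => - 1 * H p y) (e / 2) (- M).
- by move=> y; apply: cvgN; exact: cf.
- move=> p Kp; have [BH _ Hp] := HP p Kp; split; first exact: uniform_closureZ.
  by lra.
have [_ /(_ _ e2)[g Ag hg]] := uniform_closureZ (-1) Bh.
exists g => // y Ky; rewrite (splitr e).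
rewrite (le_trans (ler_distD (- 1 * h y) _ _))// lerD ?hg//.
have := fh y Ky; have : h y <= - f y + e / 2.
  apply: hc => [|p Kp].
    by have := fM _ Ky; rewrite ler_norml => /andP[]; lra.
  by have [_ /(_ y Ky) + _] := HP p Kp; lra.
by rewrite ler_norml; lra.
Qed.

End stone_weierstrass.

(** * Spectral representation of second moments *)

Lemma continuous_measurable_rV (R : realType) d (f : 'rV[R]_d -> R) :
  continuous f -> measurable_fun [set: borelRV R d] f.
Proof.
move=> /continuousP cf.
apply: (measurability _ (measurable_realfun.RGenOpens.measurableE R)).
move=> _ [_ [a [b ->]] <-].
by rewrite setTI; apply: sub_sigma_algebra; apply: cf; exact: interval_open.
Qed.

(** By recursion on the dimension, a cube is an interval times a smaller cube, and its measure is a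
    product of positive factors, starting from a Dirac mass in dimension 0. *)
Lemma lebesgue_tuple_cube_gt0 (R : realType) d (a : 'I_d -> R) (r : R) : 0 < r ->
  (0 < lebesgue_tuple R d [set t | forall i, ball (a i) r (tnth t i)])%E.
Proof.
move=> r0; elim: d a => [|d IH] a.
  rewrite /= diracE mem_set ?lte01//.
  by case.
rewrite /= /cons_measure /pushforward.
rewrite (_ : _ @^-1` _ = ball (a ord0) r `*`
    [set t | forall i, ball (a (lift ord0 i)) r (tnth t i)]); last first.
  apply/seteqP; split=> [[y t] /= yt|[y t] /= [y0 tr] i].
    split; first by have := yt ord0; rewrite (tnth_nth 0).
    by move=> i; have := yt (lift ord0 i); rewrite tnthS.
  by have [j ->|->] := unliftP ord0 i; rewrite ?tnthS// (tnth_nth 0).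
rewrite product_measure1E.
- apply: mule_gt0; last exact: IH.
  have := lebesgue_measure_ball (a ord0) (ltW r0); rewrite /= => ->.
  by rewrite lte_fin mulrn_wgt0.
- exact: measurable_realfun.measurable_ball.
- rewrite (_ : mkset _ = \bigcap_(i in [set: 'I_d])
      (fun t : d.-tuple (measurableTypeR R) => tnth t i) @^-1`
        ball (a (lift ord0 i)) r).
    apply: fin_bigcap_measurable => [|i _]; first exact: finite_finset.
    rewrite -[X in measurable X]setTI; apply: measurable_tnth => //.
    exact: measurable_realfun.measurable_ball.
  by apply/seteqP; split=> t /= tP i => [_|]; exact: tP.
Qed.

Lemma lebesgue_rV_open_gt0 (R : realType) d (U : set 'rV[R]_d) :
  open U -> U !=set0 -> (0 < lebesgue_rV (U : set (borelRV R d)))%E.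
Proof.
move=> oU [v Uv].
have /nbhs_ballP[e /= e0 veU] : nbhs v U by apply: open_nbhs_nbhs.
apply: (lt_le_trans (@lebesgue_tuple_cube_gt0 _ _ (v 0) e e0)).
rewrite /lebesgue_rV /pushforward; apply: le_measure; rewrite ?inE.
- rewrite (_ : mkset _ = \bigcap_(i in [set: 'I_d])
      (fun t : d.-tuple (measurableTypeR R) => tnth t i) @^-1` ball (v 0 i) e).
    apply: fin_bigcap_measurable => [|i _]; first exact: finite_finset.
    rewrite -[X in measurable X]setTI; apply: measurable_tnth => //.
    exact: measurable_realfun.measurable_ball.
  by apply/seteqP; split=> t /= tP i => [_|]; exact: tP.
- rewrite -[X in measurable X]setTI; apply: measurable_rV_of_tuple => //.
  exact: sub_sigma_algebra.
- move=> t /= tv; apply: veU; split=> // i j.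
  by rewrite ord1 /= mxE; exact: tv.
Qed.

Section Rintegral_sum.
Context {disp : measure_display} {T : measurableType disp} {R : realType}.
Variables (mu : {measure set T -> \bar R}) (I : finType).
Variables (c : I -> R) (f : I -> T -> R).
Hypothesis intf : forall i, mu.-integrable setT (EFin \o f i).

Lemma integrable_lincomb :
  mu.-integrable setT (EFin \o (fun t => \sum_i c i * f i t)).
Proof.
rewrite (_ : _ \o _ = fun t => (\sum_i (c i)%:E * (f i t)%:E)%E).
  apply: integrable_sum => // i _.
  by have := integrableZl measurableT (c i) (intf i).
by apply/funext => t /=; rewrite -sumEFin.
Qed.

Lemma Rintegral_lincomb :
  (\int[mu]_t (\sum_i c i * f i t))%R = \sum_i c i * (\int[mu]_t f i t)%R.
Proof.
rewrite /Rintegral.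
under eq_integral do rewrite -sumEFin.
rewrite integral_sum//; last first.
  by move=> i; have := integrableZl measurableT (c i) (intf i).
rewrite -sum_fine.
  by apply: eq_bigr => i _; rewrite -RintegralZl.
move=> i _; apply: integrable_fin_num => //.
by have := integrableZl measurableT (c i) (intf i).
Qed.

End Rintegral_sum.

Section continuous_functions.
Context (R : realType) (X : topologicalType).
Implicit Types f g : X -> R.

Lemma continuous_addr f g : continuous f -> continuous g ->
  continuous (fun y => f y + g y).
Proof. by move=> cf cg y; apply: cvgD; [exact: cf|exact: cg]. Qed.

Lemma continuous_mulr f g : continuous f -> continuous g ->
  continuous (fun y => f y * g y).
Proof. by move=> cf cg y; apply: cvgM; [exact: cf|exact: cg]. Qed.

Lemma continuous_comp_fun f (h : R -> R) : continuous f -> continuous h ->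
  continuous (fun y => h (f y)).
Proof. by move=> cf ch y; apply: continuous_comp; [exact: cf|exact: ch]. Qed.

Lemma continuous_sumr (I : Type) (s : seq I) (F : I -> X -> R) :
  (forall i, continuous (F i)) -> continuous (fun y => \sum_(i <- s) F i y).
Proof.
move=> cF; apply: (@continuous_big R^o I +%R 0 predT) => [|i _]; last exact: cF.
exact: add_continuous.
Qed.

End continuous_functions.

Section dotmul.
Context (R : realType) (d : nat).
Implicit Types u v x y : 'rV[R]_d.

Lemma dotmulC u v : dotmul u v = dotmul v u.
Proof. by apply: eq_bigr => i _; rewrite mulrC. Qed.

Lemma dotmulDl u v x : dotmul (u + v) x = dotmul u x + dotmul v x.
Proof. by rewrite /dotmul -big_split; apply: eq_bigr => i _; rewrite mxE mulrDl. Qed.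

Lemma dotmulNl u x : dotmul (- u) x = - dotmul u x.
Proof. by rewrite /dotmul -sumrN; apply: eq_bigr => i _; rewrite mxE mulNr. Qed.

Lemma dotmulBl u v x : dotmul (u - v) x = dotmul u x - dotmul v x.
Proof. by rewrite dotmulDl dotmulNl. Qed.

Lemma dotmulBr u x y : dotmul u (x - y) = dotmul u x - dotmul u y.
Proof. by rewrite !(dotmulC u) dotmulBl. Qed.

Lemma dotmul_continuousl x : continuous (fun u : 'rV[R]_d => dotmul u x).
Proof.
apply: (@continuous_sumr _ _ _ _ (fun i (u : 'rV[R]_d) => u 0 i * x 0 i)) => i.
have := @continuous_mulr _ _ (fun u : 'rV[R]_d => u 0 i) (fun=> x 0 i).
by apply; [exact: coord_continuous|exact: cst_continuous].
Qed.

Lemma dotmul_continuousr u : continuous (fun x : 'rV[R]_d => dotmul u x).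
Proof.
rewrite (_ : (fun x => _) = (fun x => dotmul x u)); first exact: dotmul_continuousl.
by apply/funext => x; rewrite dotmulC.
Qed.

Lemma coord_norm_le u i : `|u 0 i| <= `|u|.
Proof.
have /mapP[j Hj ->] : `|u 0 i| \in [seq `|u k.1 k.2| | k : 'I_1 * 'I_d].
  by apply/mapP; exists (0, i) => //=; rewrite mem_enum.
by rewrite [leRHS]/Num.norm /= mx_normrE; apply/bigmax_geP; right => /=; exists j.
Qed.

(** The norm is the sup norm, so each of the [d] terms is bounded separately, at the cost of the
    factor [d]. *)
Lemma dotmul_norm_le u x : `|dotmul u x| <= d%:R * (`|u| * `|x|).
Proof.
rewrite mulr_natl -[X in _ *+ X]card_ord -sumr_const.
rewrite (le_trans (ler_norm_sum _ _ _))//.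
by apply: ler_sum => i _; rewrite normrM ler_pM// coord_norm_le.
Qed.

End dotmul.

Lemma sqr_sum (R : comPzRingType) (I : finType) (a : I -> R) :
  (\sum_i a i) ^+ 2 = \sum_(ij : I * I) a ij.1 * a ij.2.
Proof. by rewrite expr2 big_distrlr pair_big. Qed.

Section spectral_representation.
Context {disp : measure_display} {Omega : measurableType disp} {R : realType}.
Variables (P : probability Omega R) (d : nat).
Variables (xi : 'rV[R]_d -> {RV P >-> R}) (S : 'rV[R]_d -> R).
Hypothesis xi2 : second_order_process xi.
Hypothesis xiS : has_spectral_density (cov_fun xi) S.
Local Notation lambda := (@lebesgue_rV R d).

(** The covariance is real, so the real part of the spectral formula, a cosine transform, already
    determines it. *)
Lemma cov_fun_spectral x y : cov_fun xi x y =
  (2 * pi) ^- d * (\int[lambda]_u (cos (dotmul u (x - y)) * S u))%R.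
Proof.
have [_ _ /(_ x y) /(congr1 (@complex.Re R))] := xiS.
rewrite /complex_integral /= mul0r subr0 => ->; congr (_ * _).
by apply: eq_Rintegral => u _; rewrite mulr0 subr0.
Qed.

Lemma integrable_bounded_density (g : 'rV[R]_d -> R) (C : R) :
  continuous g -> (forall u, `|g u| <= C) ->
  lambda.-integrable [set: borelRV R d] (EFin \o (fun u => g u * S u)).
Proof.
move=> cg gC; have [_ iS _] := xiS.
have mg := continuous_measurable_rV cg.
have := integrableMr measurableT mg _ iS; apply.
exists C; split; first by rewrite num_real.
by move=> M CM u _ /=; rewrite (le_trans (gC u))// ltW.
Qed.

(** This is the squared modulus of [sum_i c_i exp(i u.p_i)], the Fourier transform of a finitely
    supported measure, written with real functions. *)
Definition trig_energy (I : finType) (c : I -> R) (p : I -> 'rV[R]_d) u : R :=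
  (\sum_i c i * cos (dotmul u (p i))) ^+ 2 +
  (\sum_i c i * sin (dotmul u (p i))) ^+ 2.

Lemma trig_energyE (I : finType) (c : I -> R) (p : I -> 'rV[R]_d) u :
  trig_energy c p u = \sum_(ij : I * I)
    (c ij.1 * c ij.2) * cos (dotmul u (p ij.1 - p ij.2)).
Proof.
rewrite /trig_energy !sqr_sum -big_split; apply: eq_bigr => -[i j] _ /=.
by rewrite dotmulBr cosB; ring.
Qed.

Lemma cos_dotmul_integrable x :
  lambda.-integrable [set: borelRV R d]
    (EFin \o (fun u => cos (dotmul u x) * S u)).
Proof.
apply: (@integrable_bounded_density _ 1) => [|u]; last first.
  by rewrite ler_norml cos_geN1 cos_le1.
have := @continuous_comp_fun _ _ (fun u : 'rV[R]_d => dotmul u x) (@cos R).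
by apply; [exact: dotmul_continuousl|exact: continuous_cos].
Qed.

Lemma trig_energy_integrable (I : finType) (c : I -> R) (p : I -> 'rV[R]_d) :
  lambda.-integrable [set: borelRV R d]
    (EFin \o (fun u => trig_energy c p u * S u)).
Proof.
rewrite (_ : (fun u => _) = fun u => \sum_(ij : I * I)
    (c ij.1 * c ij.2) * (cos (dotmul u (p ij.1 - p ij.2)) * S u)).
  by apply: integrable_lincomb => ij; exact: cos_dotmul_integrable.
apply/funext => u; rewrite trig_energyE mulr_suml.
by apply: eq_bigr => ij _; rewrite mulrA.
Qed.

Lemma xi_mul_integrable x y :
  P.-integrable setT (EFin \o (fun w => xi x w * xi y w)).
Proof. by have /Lfun1_integrable := Lfun2_mul_Lfun1 (xi2 x) (xi2 y). Qed.

Lemma cov_funE x y : cov_fun xi x y = (\int[P]_w (xi x w * xi y w))%R.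
Proof. by rewrite /cov_fun unlock. Qed.

Lemma second_moment_cov (I : finType) (c : I -> R) (p : I -> 'rV[R]_d) :
  (\int[P]_w ((\sum_i c i * xi (p i) w) ^+ 2))%R =
  \sum_(ij : I * I) (c ij.1 * c ij.2) * cov_fun xi (p ij.1) (p ij.2).
Proof.
under eq_bigr do rewrite cov_funE.
rewrite -Rintegral_lincomb; last by move=> ij; exact: xi_mul_integrable.
apply: eq_Rintegral => w _; rewrite sqr_sum; apply: eq_bigr => ij _.
by rewrite mulrACA.
Qed.

(** Both sides expand over pairs of indices into the same quadratic form in [c], with the
    covariances as coefficients. *)
Lemma second_moment_spectral (I : finType) (c : I -> R) (p : I -> 'rV[R]_d) :
  (\int[P]_w ((\sum_i c i * xi (p i) w) ^+ 2))%R =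
  (2 * pi) ^- d * (\int[lambda]_u (trig_energy c p u * S u))%R.
Proof.
rewrite second_moment_cov.
under [in RHS]eq_Rintegral do rewrite trig_energyE mulr_suml.
under [in RHS]eq_Rintegral do under eq_bigr do rewrite -mulrA.
rewrite Rintegral_lincomb; last by move=> ij; exact: cos_dotmul_integrable.
rewrite mulr_sumr; apply: eq_bigr => ij _.
by rewrite cov_fun_spectral mulrCA.
Qed.

End spectral_representation.

(** * Mean square error of the kriging predictor *)

Lemma pairingD (R : realType) d n (a : 'I_n -> R) (x : 'I_n -> 'rV[R]_d)
    (f g : 'rV[R]_d -> R) :
  pairing a x (fun y => f y + g y) = pairing a x f + pairing a x g.
Proof. by rewrite /pairing -big_split; apply: eq_bigr => i _; rewrite mulrDr. Qed.

Lemma pairingZ (R : realType) d n (a : 'I_n -> R) (x : 'I_n -> 'rV[R]_d) c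
    (f : 'rV[R]_d -> R) :
  pairing a x (fun y => c * f y) = c * pairing a x f.
Proof. by rewrite /pairing mulr_sumr; apply: eq_bigr => i _; rewrite mulrCA. Qed.

Lemma pairingB (R : realType) d n (a : 'I_n -> R) (x : 'I_n -> 'rV[R]_d)
    (f g : 'rV[R]_d -> R) :
  pairing a x (fun y => f y - g y) = pairing a x f - pairing a x g.
Proof. by rewrite /pairing -sumrB; apply: eq_bigr => i _; rewrite mulrBr. Qed.

Section prediction_error.
Context (R : realType) (d n : nat).
Variables (a : 'I_n -> R) (pts : 'I_n -> 'rV[R]_d) (x : 'rV[R]_d).

(* The finitely supported measure [delta_x - lambda_{n,x}]. *)
Definition error_weight (i : 'I_n.+1) : R :=
  if unlift ord0 i is Some j then - a j else 1.
Definition error_point (i : 'I_n.+1) : 'rV[R]_d :=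
  if unlift ord0 i is Some j then pts j else x.

Lemma error_sum (F : 'rV[R]_d -> R) :
  \sum_i error_weight i * F (error_point i) = F x - pairing a pts F.
Proof.
rewrite big_ord_recl /error_weight /error_point unlift_none mul1r; congr (_ + _).
by rewrite /pairing -sumrN; apply: eq_bigr => i _; rewrite liftK mulNr.
Qed.

End prediction_error.

Section kriging_error.
Context {disp : measure_display} {Omega : measurableType disp} {R : realType}.
Variables (P : probability Omega R) (d : nat).
Variables (xi : 'rV[R]_d -> {RV P >-> R}).
Hypothesis xi2 : second_order_process xi.

Lemma lincomb_mul_integrable (I J : finType) (c : I -> R) (e : J -> R)
    (p : I -> 'rV[R]_d) (q : J -> 'rV[R]_d) :
  P.-integrable setT (EFin \o (fun w =>
    (\sum_i c i * xi (p i) w) * (\sum_j e j * xi (q j) w))).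
Proof.
rewrite (_ : (fun w => _) = fun w => \sum_(ij : I * J)
    (c ij.1 * e ij.2) * (xi (p ij.1) w * xi (q ij.2) w)).
  by apply: integrable_lincomb => ij; exact: xi_mul_integrable.
apply/funext => w; rewrite big_distrlr pair_big.
by apply: eq_bigr => ij _; rewrite mulrACA.
Qed.

Definition mean_square_error n (pts : 'I_n -> 'rV[R]_d) x (a : 'I_n -> R) : R :=
  (\int[P]_w ((xi x w - pairing a pts (fun y => xi y w)) ^+ 2))%R.

Lemma mean_square_error_spectral (S : 'rV[R]_d -> R) n
    (pts : 'I_n -> 'rV[R]_d) x (a : 'I_n -> R) :
  has_spectral_density (cov_fun xi) S ->
  mean_square_error pts x a = (2 * pi) ^- d *
    (\int[@lebesgue_rV R d]_u
      (trig_energy (error_weight a) (error_point pts x) u * S u))%R.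
Proof.
move=> xiS; rewrite -(second_moment_spectral xi2 xiS).
by apply: eq_Rintegral => w _; rewrite (error_sum _ _ _ (fun y => xi y w)).
Qed.

(** The increment [xi x - xi (pts j)] is the prediction error [V] plus an element [Z] of the span,
    and [V] is orthogonal to [Z]. *)
Lemma mean_square_error_le n (pts : 'I_n -> 'rV[R]_d) x (a : 'I_n -> R) j :
  kriging_coefficients xi pts x a ->
  mean_square_error pts x a <= (\int[P]_w ((xi x w - xi (pts j) w) ^+ 2))%R.
Proof.
move=> [_ orth].
pose V w := xi x w - pairing a pts (fun y => xi y w).
pose Z w := \sum_i (a i - (i == j)%:R) * xi (pts i) w.
have ZE w : Z w = pairing a pts (fun y => xi y w) - xi (pts j) w.
  rewrite /Z; under eq_bigr do rewrite mulrBl.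
  rewrite sumrB; congr (_ - _); rewrite (bigD1 j)//= eqxx mul1r.
  by rewrite big1 ?addr0// => i /negPf ->; rewrite mul0r.
have VE w : V w = \sum_i error_weight a i * xi (error_point pts x i) w.
  by rewrite (error_sum _ _ _ (fun y => xi y w)).
have V2 : P.-integrable setT (EFin \o (fun w => V w ^+ 2)).
  rewrite (_ : (fun w => _) = fun w =>
    (\sum_i error_weight a i * xi (error_point pts x i) w) *
    (\sum_i error_weight a i * xi (error_point pts x i) w)).
    exact: lincomb_mul_integrable.
  by apply/funext => w; rewrite VE expr2.
have VZ : P.-integrable setT (EFin \o (fun w => V w * Z w)).
  rewrite (_ : (fun w => _) = fun w =>
    (\sum_i error_weight a i * xi (error_point pts x i) w) * Z w).
    exact: lincomb_mul_integrable.
  by apply/funext => w; rewrite VE.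
have VZ0 : (\int[P]_w (V w * Z w))%R = 0.
  have := orth Z; rewrite unlock /Rintegral => -> //.
  by exists (fun i => a i - (i == j)%:R).
have VZ2 : P.-integrable setT (EFin \o (fun w => 2 * (V w * Z w))).
  by have := integrableZl measurableT 2 VZ.
(* Adding twice the vanishing integral of [V Z] reduces the claim to the pointwise inequality
   [V^2 + 2 V Z <= (V + Z)^2]. *)
rewrite /mean_square_error -[leLHS]addr0 -[X in _ + X](mulr0 2) -VZ0.
rewrite -RintegralZl// -RintegralD//; apply: le_Rintegral => //.
- by have := integrableD measurableT V2 VZ2.
- pose c b : R := if b then 1 else -1.
  pose p b := if b then x else pts j.
  rewrite (_ : (fun w => _) = fun w =>
    (\sum_(b : bool) c b * xi (p b) w) * (\sum_(b : bool) c b * xi (p b) w)).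
    exact: lincomb_mul_integrable.
  by apply/funext => w; rewrite !big_bool /= mul1r mulN1r expr2.
- move=> w _; have -> : xi x w - xi (pts j) w = V w + Z w by rewrite ZE /V; ring.
  rewrite -/(V w); move: (V w) (Z w) => v z.
  by have := sqr_ge0 z; rewrite !expr2; nra.
Qed.

Lemma increment_second_moment x y :
  (\int[P]_w ((xi x w - xi y w) ^+ 2))%R =
  cov_fun xi x x - 2 * cov_fun xi x y + cov_fun xi y y.
Proof.
pose c b : R := if b then 1 else -1.
pose p b := if b then x else y.
have := second_moment_cov xi2 c p.
under eq_Rintegral do rewrite big_bool /= mul1r mulN1r.
move=> ->.
rewrite -(pair_bigA _ (fun i j => (c i * c j) * cov_fun xi (p i) (p j))) /=.
rewrite !big_bool /= /c /p !mulN1r mulr1 mulrN1 !mul1r opprK !mulN1r mul1r.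
have -> : cov_fun xi y x = cov_fun xi x y.
  by rewrite !cov_funE; apply: eq_Rintegral => w _; rewrite mulrC.
by ring.
Qed.

End kriging_error.

(** * Mass given by the spectral density to open sets *)

Section density_mass.
Context (R : realType) (d : nat) (S : 'rV[R]_d -> R).
Local Notation lambda := (@lebesgue_rV R d).
Hypothesis S0 : forall u, 0 <= S u.
Hypothesis intS : lambda.-integrable [set: borelRV R d] (EFin \o S).
Hypothesis S_gt0 : {ae lambda, forall u, 0 < S u}.

(** Zero mass would make [S] vanish almost everywhere on [U], so [U] would be negligible, whereas
    nonempty open sets have positive Lebesgue measure. *)
Lemma density_mass_gt0 (U : set 'rV[R]_d) : open U -> U !=set0 ->
  0 < (\int[lambda]_(u in (U : set (borelRV R d))) S u)%R.
Proof.
move=> oU U0.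
have mU : measurable (U : set (borelRV R d)) by exact: sub_sigma_algebra.
have intSU : lambda.-integrable (U : set (borelRV R d)) (EFin \o S).
  exact: (integrableS measurableT).
rewrite lt_neqAle Rintegral_ge0// andbT; apply/negP => /eqP/esym iS0.
have : (\int[lambda]_(u in (U : set (borelRV R d))) `|(EFin \o S) u|)%E = 0%E.
  have := iS0; rewrite /Rintegral.
  under [in X in _ -> X = _]eq_integral do rewrite /= ger0_norm//.
  have : (\int[lambda]_(u in (U : set (borelRV R d))) (S u)%:E)%E \is a fin_num.
    by apply: integrable_fin_num.
  by case: (integral _ _ _) => //= r _ ->.
move/ae_eq_integral_abs => /(_ mU (measurable_int _ intSU)) S0ae.
have negU : lambda.-negligible (U : set (borelRV R d)).
  have : {ae lambda, forall u, ~ U u}.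
    apply: filterS2 S0ae S_gt0 => u /= SU Su Uu.
    by have := SU Uu => -[] Su0; rewrite Su0 ltxx in Su.
  by apply: negligibleS => u Uu /=; apply.
have := lebesgue_rV_open_gt0 oU U0.
by rewrite (measure_negligible mU negU) ltxx.
Qed.

(** Markov's inequality for the measure with density [S]. *)
Lemma mass_lower_bound (U : set 'rV[R]_d) (G : 'rV[R]_d -> R) (e : R) :
  open U -> (forall u, 0 <= G u) -> (forall u, U u -> e <= G u) ->
  lambda.-integrable [set: borelRV R d] (EFin \o (fun u => G u * S u)) ->
  e * (\int[lambda]_(u in (U : set (borelRV R d))) S u)%R <=
  (\int[lambda]_u (G u * S u))%R.
Proof.
move=> oU G0 eG intG.
have mU : measurable (U : set (borelRV R d)) by exact: sub_sigma_algebra.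
have intSU : lambda.-integrable (U : set (borelRV R d)) (EFin \o S).
  exact: (integrableS measurableT).
rewrite -RintegralZl// Rintegral_mkcond; apply: le_Rintegral => //.
  have := (@integrable_mkcond _ (borelRV R d) R lambda U
    (fun u => (e * S u)%:E) mU).1.
  rewrite restrict_EFin; apply.
  by have := integrableZl mU e intSU.
move=> u _; rewrite patchE; case: ifPn => [/set_mem Uu|_].
  by rewrite ler_wpM2r// eG.
by rewrite mulr_ge0.
Qed.

End density_mass.

(** * Trigonometric polynomials *)

Lemma lipschitz1_of_derive (R : realType) (h dh : R -> R) :
  (forall t : R, is_derive t 1 h (dh t)) -> (forall t, `|dh t| <= 1) ->
  forall s t, `|h s - h t| <= `|s - t|.
Proof.
move=> hd dh1 s t; wlog st : s t / s <= t.
  move=> H; have [/H//|/ltW/H] := leP s t.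
  by rewrite distrC (distrC t).
have ch : {within `[s, t], continuous h}.
  apply: continuous_subspaceT => y; apply: differentiable_continuous.
  by apply/derivable1_diffP; have [] := hd y.
have [c _ hst] := MVT_segment st (fun y _ => hd y) ch.
by rewrite distrC [leRHS]distrC hst normrM ler_piMl.
Qed.

Lemma cos_lipschitz (R : realType) (s t : R) : `|cos s - cos t| <= `|s - t|.
Proof.
apply: (@lipschitz1_of_derive _ _ (fun y => - sin y)) => y.
by rewrite normrN ler_norml sin_geN1 sin_le1.
Qed.

Lemma sin_lipschitz (R : realType) (s t : R) : `|sin s - sin t| <= `|s - t|.
Proof.
apply: (@lipschitz1_of_derive _ _ (@cos R)) => y.
by rewrite ler_norml cos_geN1 cos_le1.
Qed.

Section trigonometric_polynomials.
Context (R : realType) (d : nat).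

(** The phase [t] makes one kind of monomial cover sines and cosines, and the product-to-sum formula
    then gives closure under products. *)
Inductive trig_polynomial : set ('rV[R]_d -> R) :=
| trig_monomial c u t : trig_polynomial (fun y => c * cos (dotmul u y + t))
| trig_add f g : trig_polynomial f -> trig_polynomial g ->
    trig_polynomial (fun y => f y + g y).

Lemma trig_polynomial_continuous f : trig_polynomial f -> continuous f.
Proof.
elim=> [c u t|{}f g _ cf _ cg]; last exact: continuous_addr.
apply: continuous_mulr; first exact: cst_continuous.
apply: (@continuous_comp_fun _ _ (fun y => dotmul u y + t));
  last exact: continuous_cos.
apply: continuous_addr; last exact: cst_continuous.
exact: dotmul_continuousr.
Qed.

Lemma trig_polynomial_cst c : trig_polynomial (fun=> c).
Proof.
have := trig_monomial c 0 0; congr trig_polynomial; apply/funext => y.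
rewrite /dotmul big1 ?addr0 ?cos0 ?mulr1// => i _.
by rewrite mxE mul0r.
Qed.

Lemma trig_polynomialM f g : trig_polynomial f -> trig_polynomial g ->
  trig_polynomial (fun y => f y * g y).
Proof.
elim=> [c u t|f1 f2 _ IH1 _ IH2] Tg; last first.
  have := trig_add (IH1 Tg) (IH2 Tg); congr trig_polynomial.
  by apply/funext => y; rewrite mulrDl.
elim: Tg => [c' u' t'|g1 g2 _ IH1 _ IH2]; last first.
  have := trig_add IH1 IH2; congr trig_polynomial.
  by apply/funext => y; rewrite mulrDr.
have := trig_add (trig_monomial (c * c' / 2) (u + u') (t + t'))
  (trig_monomial (c * c' / 2) (u - u') (t - t')).
congr trig_polynomial; apply/funext => y; rewrite dotmulDl dotmulBl.
set v := dotmul u y + t; set w := dotmul u' y + t'.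
have -> : dotmul u y + dotmul u' y + (t + t') = v + w by rewrite /v /w; ring.
have -> : dotmul u y - dotmul u' y + (t - t') = v - w by rewrite /v /w; ring.
by rewrite cosD cosB; field.
Qed.

Lemma trig_polynomial_separates (p q : 'rV[R]_d) : p != q ->
  exists2 f, trig_polynomial f & f p != f q.
Proof.
move=> /eqP pq; have [i pqi] : exists i, p 0 i != q 0 i.
  apply: contrapT => /forallNP pq'; apply: pq; apply/rowP => i.
  by apply/eqP; apply: contrapT => /negP; exact: pq'.
(* This frequency makes the phases at [p] and [q] differ by exactly 1. After a shift the cosine is 1
   at [q] and [cos 1] at [p], distinct because cosine is injective on [[0, pi]]. *)
pose u : 'rV[R]_d := (p 0 i - q 0 i)^-1 *: delta_mx 0 i.
have uE y : dotmul u y = (p 0 i - q 0 i)^-1 * y 0 i.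
  rewrite /dotmul (bigD1 i)//= !mxE !eqxx mulr1 big1 ?addr0// => j /negPf ji.
  by rewrite !mxE ji andbF mulr0 mul0r.
exists (fun y => 1 * cos (dotmul u y + - dotmul u q)); first exact: trig_monomial.
rewrite !mul1r subrr cos0 -dotmulBr uE !mxE mulVf ?subr_eq0//.
apply/eqP => cos1; have : (1 : R) = 0.
  apply: (@cos_inj R); rewrite ?in_itv /= ?lexx ?ler01 ?pi_ge0//.
    by rewrite (le_trans _ (pi_ge2 R))// ler1n.
  by rewrite cos1 cos0.
by move/eqP; rewrite oner_eq0.
Qed.

Lemma trig_polynomial_dense (B : R) (f : 'rV[R]_d -> R) (e : R) :
  continuous f -> 0 < e -> exists2 g, trig_polynomial g &
    forall y, `|y| <= B -> `|f y - g y| <= e.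
Proof.
move=> cf e0; apply: (@stone_weierstrass _ 'rV[R]_d [set y | `|y| <= B]) => //.
- apply: bounded_closed_compact.
    exists B; split; rewrite ?num_real// => M BM y /= yB.
    by rewrite (le_trans yB)// ltW.
  apply: (@closed_comp _ _ (fun y : 'rV[R]_d => `|y|) [set r | r <= B]).
    by move=> y _; exact: norm_continuous.
  exact: closed_le.
- exact: trig_polynomial_continuous.
- exact: trig_polynomial_cst.
- exact: trig_add.
- exact: trig_polynomialM.
- by move=> p q _ _; exact: trig_polynomial_separates.
Qed.

End trigonometric_polynomials.

(** * Convergence of the kriging measures *)

Lemma closure_range_approx (R : realType) (X : topologicalType) (pts : nat -> X)
    (x : X) (h : X -> R) : continuous h -> closure (range pts) x -> h x = 0 ->
  forall e, 0 < e -> exists j, h (pts j) < e.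
Proof.
move=> ch clx hx e e0.
have /clx[_ [[j _ <-] hj]] : nbhs x [set y | h y < e].
  have := ch x => /cvgrPdist_lt/(_ e e0); apply: filterS => y.
  by rewrite hx sub0r normrN => /ltr_normlW.
by exists j.
Qed.

(** For a covariance [k], the function is the mean square increment between [x] and [y]; it vanishes
    at [y = x]. *)
Lemma continuous_variogram (R : realType) (X : topologicalType)
    (k : X -> X -> R) (x : X) : continuous (fun p : X * X => k p.1 p.2) ->
  continuous (fun y => k x x - 2 * k x y + k y y).
Proof.
move=> ck y; apply: cvgD; last first.
  apply: (@continuous_comp _ _ _ (fun y => (y, y)) (fun p => k p.1 p.2));
    last exact: ck.
  by apply: cvg_pair; exact: cvg_id.
apply: cvgB; first exact: cvg_cst.
apply: cvgMr; apply: (@continuous_comp _ _ _ (fun y => (x, y)) (fun p => k p.1 p.2)).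
  by apply: cvg_pair; [exact: cvg_cst|exact: cvg_id].
exact: ck.
Qed.

Section kriging_convergence.
Context {disp : measure_display} {Omega : measurableType disp} {R : realType}.
Variables (P : probability Omega R) (d : nat).
Variables (xi : 'rV[R]_d -> {RV P >-> R}) (S : 'rV[R]_d -> R).
Variables (pts : nat -> 'rV[R]_d) (x : 'rV[R]_d).
Variable a : forall n, 'I_n -> R.
Hypothesis xi2 : second_order_process xi.
Hypothesis cov_continuous :
  continuous (fun p : 'rV[R]_d * 'rV[R]_d => cov_fun xi p.1 p.2).
Hypothesis xiS : has_spectral_density (cov_fun xi) S.
Hypothesis S_gt0 : {ae @lebesgue_rV R d, forall u, 0 < S u}.
Hypothesis a_kriging : forall n, (1 <= n)%N ->
  kriging_coefficients xi (fun i : 'I_n => pts i) x (@a n).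
Hypothesis clx : closure (range pts) x.
Local Notation L n f := (pairing (@a n) (fun i : 'I_n => pts i) f).

Lemma mean_square_error_cvg0 (e : R) : 0 < e -> exists N, forall n, (N <= n)%N ->
  (1 <= n)%N /\ mean_square_error xi (fun i : 'I_n => pts i) x (@a n) < e.
Proof.
move=> e0; have [|j hj] := closure_range_approx
    (@continuous_variogram _ _ _ x cov_continuous) clx _ e0.
  by ring.
(* From [j.+1] on, the point of index [j] is among the data and [n] is at least 1. *)
exists j.+1 => n jn; have n1 : (1 <= n)%N by exact: leq_trans jn.
split => //; apply: le_lt_trans hj; rewrite -(increment_second_moment xi2).
exact: (mean_square_error_le xi2 (Ordinal jn) (a_kriging n1)).
Qed.

Variables B M : R.
Hypothesis xB : `|x| <= B.
Hypothesis ptsB : forall n, `|pts n| <= B.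
Hypothesis LM : forall n f C, (1 <= n)%N -> (forall i, `|f (pts i)| <= C) ->
  `|L n f| <= C * M.

Let M0 : 0 <= M.
Proof.
have := @LM 1 (fun=> 1) 1 isT; rewrite normr1 mul1r => /(_ (fun=> lexx _)).
exact: le_trans.
Qed.

(* The errors at frequency [u] are Lipschitz in [u], uniformly in [n]; so if one
   of them were not small, the mean square error, which is their squared
   L^2(S)-norm, would be bounded below by the S-mass of a fixed ball. *)
Lemma frequency_cvg (h : R -> R) (u : 'rV[R]_d) (e : R) :
  (forall s t, `|h s - h t| <= `|s - t|) ->
  (forall n v, (h (dotmul v x) - L n (fun y => h (dotmul v y))) ^+ 2 <=
    trig_energy (error_weight (@a n)) (error_point (fun i : 'I_n => pts i) x) v) ->
  0 < e -> exists N, forall n, (N <= n)%N ->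
  `|h (dotmul u x) - L n (fun y => h (dotmul u y))| <= e.
Proof.
move=> lip hE e0; have [S0 intS _] := xiS.
have B0 : 0 <= B by exact: le_trans xB.
(* Moving the frequency by less than [r] changes the error by at most [r * A]; the term at [x] gives
   the 1 and the pairing gives [M]. The choice of [r] makes this at most [e / 2], with [A + 1]
   keeping the denominator positive. *)
pose A := d%:R * B * (1 + M).
have A0 : 0 <= A by rewrite !mulr_ge0// addr_ge0.
pose r := e / 2 / (A + 1).
have r0 : 0 < r by rewrite !divr_gt0// ltr_wpDl.
pose U := ball u r.
have oU : open U by exact: ball_open.
have U0 : U !=set0 by exists u; exact: ballxx.
have mass0 := density_mass_gt0 S0 intS S_gt0 oU U0.
set m := Rintegral _ _ _ in mass0.
have pi2 : 0 < (2 * pi : R) ^- d by rewrite invr_gt0 exprn_gt0// mulr_gt0// pi_gt0.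
(* The threshold is the least mean square error possible if the frequency error is at least [e / 2]
   on the whole ball [U]. *)
have [|N NP] := @mean_square_error_cvg0 ((2 * pi) ^- d * ((e / 2) ^+ 2 * m)).
  by rewrite !mulr_gt0// exprn_gt0// divr_gt0.
exists N => n /NP[n1 mse_lt]; rewrite leNgt; apply/negP => eu.
move: mse_lt; apply/negP; rewrite -leNgt.
rewrite (mean_square_error_spectral xi2 _ _ _ xiS) ler_pM2l//.
apply: mass_lower_bound => //; last exact: (trig_energy_integrable xiS).
  by move=> v; rewrite addr_ge0// sqr_ge0.
move=> v; rewrite /U -ball_normE /= => uv; apply: le_trans (hE n v).
rewrite -[leRHS]real_normK ?num_real// ler_pXn2r// ?nnegrE ?divr_ge0// ?ltW//.
have dot_lip y : `|y| <= B -> `|h (dotmul u y) - h (dotmul v y)| <= d%:R * (r * B).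
  move=> yB; apply: (le_trans (lip _ _)); rewrite -dotmulBl.
  apply: (le_trans (dotmul_norm_le _ _)); rewrite ler_wpM2l// ler_pM//.
  exact: ltW.
have Llip : `|L n (fun y => h (dotmul u y)) - L n (fun y => h (dotmul v y))| <=
    d%:R * (r * B) * M.
  rewrite -pairingB; apply: LM => // i; exact: dot_lip.
have xlip := dot_lip x xB.
have rA : d%:R * (r * B) + d%:R * (r * B) * M <= e / 2.
  rewrite (_ : _ + _ = r * A); last by rewrite /A; ring.
  rewrite /r mulrAC ler_pdivrMr ?ltr_wpDl// ler_wpM2l ?lerDl//.
  by rewrite divr_ge0// ltW.
move: eu Llip xlip rA.
move: (h _) (h _) (L n _) (L n _) (d%:R * (r * B)) => p q s t K eu.
rewrite !ler_distl => /andP[H1 H2] /andP[H3 H4] rA.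
rewrite ltNge; apply/negP; rewrite ler_norml => /andP[H5 H6].
by move: eu; rewrite ltNge ler_norml => /negP; apply; apply/andP; split; lra.
Qed.

Lemma trig_polynomial_cvg (f : 'rV[R]_d -> R) : trig_polynomial f ->
  forall e, 0 < e -> exists N, forall n, (N <= n)%N -> `|f x - L n f| <= e.
Proof.
elim=> [c u t|{}f g _ IHf _ IHg] e e0; last first.
  have e2 : 0 < e / 2 by rewrite divr_gt0.
  have [N1 N1P] := IHf _ e2; have [N2 N2P] := IHg _ e2.
  exists (maxn N1 N2) => n; rewrite geq_max => /andP[/N1P fn /N2P gn].
  by rewrite pairingD opprD addrACA (splitr e) (le_trans (ler_normD _ _))// lerD.
(* The cosine and sine parts have coefficients of modulus at most [|c|], so each gets half of [e];
   the added 1 covers [c = 0]. *)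
pose e' := e / 2 / (`|c| + 1).
have e'0 : 0 < e' by rewrite !divr_gt0// ltr_wpDl.
have ce' : `|c| * e' <= e / 2.
  have c1 : `|c| / (`|c| + 1) <= 1 by rewrite ler_pdivrMr ?ltr_wpDl// mul1r lerDl.
  by rewrite /e' mulrCA ler_piMr// divr_ge0// ltW.
have [|N1 N1P] := @frequency_cvg (@cos R) u e' (@cos_lipschitz R) _ e'0.
  move=> n v; rewrite /trig_energy (error_sum _ _ _ (fun y => cos (dotmul v y))).
  by rewrite lerDl sqr_ge0.
have [|N2 N2P] := @frequency_cvg (@sin R) u e' (@sin_lipschitz R) _ e'0.
  move=> n v; rewrite /trig_energy (error_sum _ _ _ (fun y => sin (dotmul v y))).
  by rewrite lerDr sqr_ge0.
exists (maxn N1 N2) => n; rewrite geq_max => /andP[/N1P cn /N2P sn].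
have cosE y : c * cos (dotmul u y + t) =
    c * cos t * cos (dotmul u y) + - (c * sin t) * sin (dotmul u y).
  by rewrite cosD; ring.
rewrite cosE (funext cosE).
rewrite pairingD !pairingZ opprD addrACA -!mulrBr (splitr e).
rewrite (le_trans (ler_normD _ _))// !normrM normrN normrM lerD//.
  apply: le_trans ce'; rewrite ler_pM// ler_piMr//.
  by rewrite ler_norml cos_geN1 cos_le1.
apply: le_trans ce'; rewrite ler_pM// ler_piMr//.
by rewrite ler_norml sin_geN1 sin_le1.
Qed.

Lemma kriging_cvg (f : 'rV[R]_d -> R) : continuous f -> L n f @[n --> \oo] --> f x.
Proof.
move=> cf; apply/cvgrPdist_le => e e0.
(* The budget is [e'] for [f - g] at [x], [e'] for the convergence on [g], and [e' * M] for the
   pairing with [f - g]. *)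
pose e' := e / (2 + M).
have e'0 : 0 < e' by rewrite divr_gt0// ltr_wpDr.
have [g Tg fg] := trig_polynomial_dense B cf e'0.
have [N NP] := trig_polynomial_cvg Tg e'0.
exists (maxn N 1) => // n; rewrite /= geq_max => /andP[Nn n1].
have H1 := fg x xB; have H2 := NP n Nn.
have H3 : `|L n f - L n g| <= e' * M.
  by rewrite -pairingB; apply: LM => // i; exact: fg.
have -> : e = e' + e' + e' * M by rewrite /e'; field; rewrite gt_eqF// ltr_wpDr.
rewrite (_ : _ - _ = (f x - g x) + (g x - L n g) - (L n f - L n g)); last by ring.
rewrite (le_trans (ler_normB _ _))// lerD//.
by rewrite (le_trans (ler_normD _ _))// lerD.
Qed.

End kriging_convergence.

(* pts n is the point x_{n+1} of the informal sequence (x_n)_{n >= 1}. *)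
Theorem theorem2 (R : realType) (disp : measure_display)
    (Omega : measurableType disp) (P : probability Omega R) (d : nat)
    (xi : 'rV[R]_d -> {RV P >-> R}) (S : 'rV[R]_d -> R)
    (pts : nat -> 'rV[R]_d)
    (lambda : forall n : nat, 'rV[R]_d -> 'I_n -> R) :
  second_order_process xi ->
  zero_mean xi ->
  continuous (fun p : 'rV[R]_d * 'rV[R]_d => cov_fun xi p.1 p.2) ->
  second_order_stationary xi ->
  has_spectral_density (cov_fun xi) S ->
  (exists (C : R) (r : nat), [/\ 0 < C, (1 <= r)%N &
     {ae @lebesgue_rV R d, forall u, C <= S u * (1 + enorm u ^+ r)}]) ->
  bounded_set (range pts) ->
  (forall (n : nat) (x : 'rV[R]_d), (1 <= n)%N ->
     kriging_coefficients xi (fun i : 'I_n => pts i) x (lambda n x)) ->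
  forall x : 'rV[R]_d, closure (range pts) x ->
    (forall f : 'rV[R]_d -> R, continuous f ->
       pairing (lambda n x) (fun i : 'I_n => pts i) f @[n --> \oo] --> f x)
    <->
    (ereal_sup [set tv_norm (kriging_measure (lambda n x) (fun i : 'I_n => pts i))
               | n in [set n : nat | (1 <= n)%N]] < +oo)%E.
Proof.
move=> xi2 _ kcont _ xiS [C [r [C0 _ SC]]] [B0 [_ B0P]] krig x clx; split.
  move=> cvgL; have [f cf|T TP] := @bounded_tv_norm R d id
      (fun n => lambda n x) (fun n (i : 'I_n) => pts i).
    have /cvg_seq_bounded[T [_ TP]] : cvgn (fun n =>
        pairing (lambda n x) (fun i : 'I_n => pts i) f).
      by apply/cvg_ex; exists (f x); exact: cvgL.
    by exists (T + 1) => n; apply: TP => //; rewrite ltrDl.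
  apply: (@le_lt_trans _ _ T%:E); last exact: ltry.
  by apply: ge_ereal_sup => _ [n _ <-]; exact: TP.
move=> supfin; have [M MP] : exists M : R, forall n, (1 <= n)%N ->
    fine (tv_norm (kriging_measure (lambda n x) (fun i : 'I_n => pts i))) <= M.
  (* The supremum is not [+oo] by assumption, nor [-oo] because it dominates a finite variation;
     hence [fine s] is a genuine bound. *)
  set s := ereal_sup _ in supfin; exists (fine s) => n n1.
  have tvs : (tv_norm (kriging_measure (lambda n x) (fun i : 'I_n => pts i)) <= s)%E.
    by apply: ereal_sup_ubound; exists n.
  have tvfin := tv_norm_fin (lambda n x) (fun i : 'I_n => pts i).
  apply: fine_le => //; move: supfin tvs tvfin; case: (s) => //.
  by rewrite leeNy_eq => _ /eqP ->.
have S_gt0 : {ae @lebesgue_rV R d, forall u, 0 < S u}.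
  (* Where [S] vanishes, the spectral lower bound would read [C <= 0]. *)
  apply: negligibleS SC => u /= Su0 CS; apply: Su0; have [S0 _ _] := xiS.
  rewrite lt_neqAle S0 andbT; apply/negP => /eqP Su.
  by move: CS; rewrite -Su mul0r leNgt C0.
(* Boundedness of the data only provides bounds strictly above [B0], hence [B0 + 1]. *)
pose B := Num.max `|x| (B0 + 1).
have xB : `|x| <= B by rewrite le_max lexx.
have ptsB n : `|pts n| <= B.
  by rewrite le_max; apply/orP; right; apply: B0P; [rewrite ltrDl|exists n].
apply: (@kriging_cvg _ _ _ P d xi S pts x (fun n => lambda n x) xi2 kcont xiS S_gt0
  (fun n => krig n x) clx B M xB ptsB) => n f K n1 fK.
have K0 : 0 <= K by exact: le_trans (fK 0%N).
have := @pairing_tv _ _ _ (lambda n x) (fun i : 'I_n => pts i) f K.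
move=> /(_ (fun i => fK i)) /le_trans; apply.
by rewrite ler_wpM2l ?MP.
Qed.
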